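(* Let $n\ge 3$, let $u,w\in S^D_n$, and let $j'\in S^D_{n-1}$ be the join, in the weak order of $S^D_{n-1}$, of the parabolic projections of $u$ and $w$ to $S^D_{n-1}$. For $p\in\{\pm1,\ldots,\pm n\}$ define $j^{(p)}\in S^D_n$ in window notation as follows, where $j'_i=j'(i)$: for $p>0$, $j^{(p)}$ is obtained from the window $j'_1j'_2\cdots j'_{n-1}$ by inserting $n$ so that it occupies position $p$; for $p<0$, $j^{(p)}$ is obtained from the modified window $\overline{j'_1}\,j'_2\cdots j'_{n-1}$ (the sign of the first entry flipped) by inserting $\overline{n}$ so that it occupies position $|p|$. Then the join $u\vee w$ in the weak order of $S^D_n$ equals $j^{(p)}$, where $p$ is the largest element of $\{\pm1,\ldots,\pm n\}$ such that the following condition holds for $j=j^{(p)}$: whenever $k\in\pm[n-1]$ occurs to the right of $n$ in the complete notation of $u$ or of $w$, then $k$ occurs to the right of $n$ in the complete notation of $j$.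
   Context: For $n\ge2$, $S^D_n$ is the group of even signed permutations of $[n]=\{1,\ldots,n\}$: permutations $w$ of $\pm[n]=\{\pm1,\ldots,\pm n\}$ with $w(-i)=-w(i)$ and an even number of negative values among $w(1),\ldots,w(n)$. Write $\overline{i}$ for $-i$. It is a Coxeter group (with product given by composition of maps) with generators $S=\{s_0,\ldots,s_{n-1}\}$, $s_0=(\overline2\ 1)(\overline1\ 2)$ and $s_i=(\overline{i+1}\ \overline i)(i\ i+1)$ for $1\le i\le n-1$. For $n\geq 3$ and $I=\{s_0,\ldots,s_{n-2}\}$ the standard parabolic subgroup generated by $I$ is $S^D_{n-1}$ (elements fixing $n$). The window notation of $w$ is $w(1)w(2)\cdots w(n)$ and the complete notation is $w(-n)\cdots w(-1)\mid w(1)\cdots w(n)$; thus $k$ occurs to the right of $n$ in the complete notation of $w$ iff $w^{-1}(k)>w^{-1}(n)$. The (right) weak order on a finite Coxeter group is: $u\le w$ iff $T_L(u)\subseteq T_L(w)$, where $T_L(w)$ is the set of reflections $t$ with $\ell(tw)<\ell(w)$; it is a lattice. The parabolic projection of $w\in S^D_n$ to $S^D_{n-1}$ is the unique element $w_I\in S^D_{n-1}$ such that $w=w_I\,{}^Iw$ with $\ell(s\,{}^Iw)>\ell({}^Iw)$ for all $s\in I$. *)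

(* Defs.v *)
From HB Require Import structures.
From mathcomp Require Import all_boot all_order all_algebra all_fingroup.
From mathcomp Require Import zify.

Set Implicit Arguments.
Unset Strict Implicit.
Unset Printing Implicit Defensive.

Import Order.TTheory GRing.Theory Num.Theory.
Local Open Scope ring_scope.

(* Permutation groups are taken with the product "composition of maps",
   (u \oS v) x = u (v x), which is the opposite of the product of perm.v.
   Notions below that are insensitive to this reversal (powers of sets of
   generators, conjugacy, generated subgroups) are those of fingroup. *)
Definition pcomp (T : finType) (u v : {perm T}) : {perm T} := (v * u)%g.
Notation "u \oS v" := (pcomp u v) (at level 40, left associativity).

Lemma pcompE (T : finType) (u v : {perm T}) x : (u \oS v) x = u (v x).
Proof. exact: permM. Qed.

Section Coxeter.
Variables (T : finType) (S : {set {perm T}}).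
Implicit Types u w j : {perm T}.

Fact exists_word w : w \in <<S>>%g -> exists k, w \in (S ^+ k)%g.
Proof.
case/gen_prodgP=> k [c Sc ->]; exists k; elim: k c Sc => [|k IHk] c Sc.
  by rewrite big_ord0 expg0 inE.
by rewrite big_ord_recl expgS mem_mulg ?IHk.
Qed.

(* The least length of a word in S representing w; only meaningful on the
   group generated by S (it is set to 0 elsewhere).  All systems considered
   here are finite and generated by involutions, so inverses are not needed. *)
Definition cox_length w : nat :=
  if (w \in <<S>>%g) =P true is ReflectT Sw then ex_minn (exists_word Sw) else 0%N.

Lemma cox_lengthP w : w \in <<S>>%g ->
  w \in (S ^+ cox_length w)%g /\
  (forall k, w \in (S ^+ k)%g -> (cox_length w <= k)%N).
Proof.
rewrite /cox_length; case: eqP => // Sw _.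
by case: ex_minnP => k wk min_k; split.
Qed.

Definition reflections : {set {perm T}} := class_support S <<S>>%g.

Definition left_inversions w : {set {perm T}} :=
  [set t in reflections | (cox_length (t \oS w) < cox_length w)%N].

Definition weak_le u w : bool := left_inversions u \subset left_inversions w.

(* j is the join of u and w in the weak order, relative to the generating
   set S, on the set W of elements of the group. *)
Definition is_join (W : {set {perm T}}) u w j : Prop :=
  [/\ j \in W, weak_le u j, weak_le w j &
      forall x, x \in W -> weak_le u x -> weak_le w x -> weak_le j x].

End Coxeter.

(* The set {-n, ..., -1, 1, ..., n}: the pair (b, i) encodes i + 1 if b is
   false, and -(i + 1) if b is true. *)
Notation pm n := (bool * 'I_n)%type.

Definition pmZ n (x : pm n) : int := if x.1 then - (x.2.+1)%:Z else (x.2.+1)%:Z.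
Definition pmN n (x : pm n) : pm n := (~~ x.1, x.2).

Lemma pmZN n (x : pm n) : pmZ (pmN x) = - pmZ x.
Proof. by case: x => [[] i]; rewrite /pmZ /= ?opprK. Qed.

Lemma pmZ_inj n : injective (@pmZ n).
Proof.
case=> [b i] [c k]; rewrite /pmZ /=; case: b c => [] [] /= E; try lia.
- by congr (_, _); apply: val_inj => /=; lia.
- by congr (_, _); apply: val_inj => /=; lia.
Qed.

Definition window n (w : {perm pm n}) : seq int :=
  [seq pmZ (w (false, i)) | i <- enum 'I_n].

Definition complete n (w : {perm pm n}) : seq int :=
  [seq - z | z <- rev (window w)] ++ window w.

Definition SD n : {set {perm pm n}} :=
  [set w : {perm pm n} | [forall x, w (pmN x) == pmN (w x)]
           && ~~ odd (count (fun z : int => z < 0) (window w))].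

(* The elements of SD n that fix n, i.e. the parabolic copy of SD n.-1. *)
Definition SDpar n : {set {perm pm n}} :=
  [set w in SD n | [forall x, (pmZ x == n%:Z) ==> (w x == x)]].

(* The involution (-x -y)(x y). *)
Definition strans n (x y : pm n) : {perm pm n} :=
  (tperm (pmN x) (pmN y) * tperm x y)%g.

(* s_0 = (-2 1)(-1 2), and s_k = (-(k+1) -k)(k k+1) for k > 0.  Since 'I_n
   is zero-based, the integers k and k+1 are the ordinals ord_pred k and k. *)
Definition sD n (k : 'I_n) : {perm pm n} :=
  if k == 0%N :> nat then strans (false, k) (true, ordS k)
  else strans (false, ord_pred k) (false, k).

Definition simpleD n : {set {perm pm n}} := [set sD k | k : 'I_n].

(* s_0, ..., s_{n-2} *)
Definition simpleDpar n : {set {perm pm n}} := [set sD k | k : 'I_n & (k.+1 < n)%N].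

Definition is_parproj n (w wI : {perm pm n}) : Prop :=
  wI \in SDpar n /\
  exists v, [/\ v \in SD n, w = wI \oS v &
    forall s, s \in simpleDpar n ->
      (cox_length (simpleD n) v < cox_length (simpleD n) (s \oS v))%N].

Definition right_of_n n (w : {perm pm n}) (k : int) : bool :=
  (index n%:Z (complete w) < index k (complete w))%N.

(* p = (b, i) denotes the position +(i+1) or -(i+1), so that i entries precede
   the inserted one. *)
Definition ins_window n (j' : {perm pm n}) (p : pm n) : seq int :=
  let j0 := take n.-1 (window j') in
  if p.1 then
    let j1 := - head 0 j0 :: behead j0 in
    take p.2 j1 ++ - n%:Z :: drop p.2 j1
  else take p.2 j0 ++ n%:Z :: drop p.2 j0.

(* The element of SD n with window s; the default value 1 is irrelevant, as
   ins_permP below shows. *)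
Definition of_window n (s : seq int) : {perm pm n} :=
  odflt 1%g [pick w in SD n | window w == s].

Definition ins_perm n (j' : {perm pm n}) (p : pm n) : {perm pm n} :=
  of_window n (ins_window j' p).

Lemma size_window n (w : {perm pm n}) : size (window w) = n.
Proof. by rewrite size_map size_enum_ord. Qed.

Lemma nth_window n (w : {perm pm n}) (i : 'I_n) :
  nth 0 (window w) i = pmZ (w (false, i)).
Proof. by rewrite (nth_map i) ?size_enum_ord // nth_ord_enum. Qed.

Lemma of_windowP n (s : seq int) :
    size s = n -> all (fun z : int => (0 < `|z| <= n)%N) s ->
    uniq [seq `|z|%N | z <- s] -> ~~ odd (count (fun z : int => z < 0) s) ->
  of_window n s \in SD n /\ window (of_window n s) = s.
Proof.
move=> sz_s s_bd s_uniq s_even; rewrite /of_window.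
suff [w Dw ws]: exists2 w, w \in SD n & window w = s.
  by case: pickP => [v /andP[Dv /eqP vs] // | /(_ w)]; rewrite Dw ws eqxx.
have bd (i : 'I_n) : (0 < `|nth 0%R s i| <= n)%N.
  by apply: (allP s_bd); rewrite mem_nth ?sz_s.
have lt (i : 'I_n) : (`|nth 0%R s i|.-1 < n)%N by have := bd i; lia.
pose f (x : pm n) : pm n := (x.1 (+) (nth 0 s x.2 < 0), Ordinal (lt x.2)).
have f_inj : injective f.
  move=> [b i] [c k] E; have /= bc := congr1 fst E.
  have /= ik := congr1 (fun x : pm n => val x.2) E.
  have Eik : i = k.
    apply: val_inj; apply/eqP => /=.
    rewrite -(nth_uniq 0%N _ _ s_uniq) ?size_map ?sz_s //.
    rewrite !(nth_map 0) ?sz_s //; apply/eqP.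
    by move: (bd i) (bd k) ik; do 2!case: absz => [|?] //; move=> _ _ /= ->.
  by move: bc; rewrite Eik => /addIb->.
have win : window (perm f_inj) = s.
  apply: (@eq_from_nth _ 0); rewrite size_window // => i lt_i.
  rewrite (nth_window _ (Ordinal lt_i)) permE /f /pmZ /=.
  by have := bd (Ordinal lt_i) => /=; case: ifP => ?; lia.
exists (perm f_inj) => //; rewrite inE win s_even andbT.
apply/forallP=> x; rewrite !permE /f /pmN /=.
by apply/eqP; congr (_, _); rewrite addNb.
Qed.

Lemma window_bound n (w : {perm pm n}) :
  all (fun z : int => (0 < `|z| <= n)%N) (window w).
Proof.
apply/allP=> _ /mapP[i _ ->]; rewrite /pmZ.
by case: (w _) => [[] k] /=; have := ltn_ord k; lia.
Qed.

Lemma window_uniq n (w : {perm pm n}) :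
  w \in SD n -> uniq [seq `|z|%N | z <- window w].
Proof.
rewrite inE => /andP[/forallP wN _]; rewrite -map_comp map_inj_uniq ?enum_uniq //.
move=> i k Eik.
have [E|E] : w (false, i) = w (false, k) \/ w (false, i) = pmN (w (false, k)).
- move: Eik; rewrite /= /pmZ /pmN.
  move: (w (false, i)) (w (false, k)) => [b x] [c y] /= E; have -> : x = y.
    by apply: val_inj => /=; case: b c E => [] [] /= E; lia.
  by case: b c {E} => [] []; [left | right | right | left].
- by move/perm_inj: E => [].
- have /eqP wNk := wN (false, k).
  by move: E; rewrite -wNk => /perm_inj [].
Qed.

Lemma window_SDpar n (w : {perm pm n}) : (0 < n)%N -> w \in SDpar n ->
  window w = rcons (take n.-1 (window w)) n%:Z.
Proof.
case: n w => // n w _; rewrite inE => /andP[_ /forallP w_fix].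
rewrite -[LHS](cat_take_drop n) -cats1 /=; congr (_ ++ _).
rewrite (drop_nth 0) ?size_window // drop_oversize ?size_window //.
rewrite -[X in nth _ _ X]/(val (@ord_max n)) nth_window.
have /implyP/(_ (eqxx _))/eqP-> := w_fix (false, ord_max).
by [].
Qed.

Lemma ins_permP n (j' : {perm pm n}) (p : pm n) :
    (2 <= n)%N -> j' \in SDpar n ->
  ins_perm j' p \in SD n /\ window (ins_perm j' p) = ins_window j' p.
Proof.
move=> n_ge2 Dj; have Dj' : j' \in SD n by move: Dj; rewrite inE => /andP[].
have n_gt0 : (0 < n)%N by lia.
have := window_SDpar n_gt0 Dj; have := window_bound j'; have := window_uniq Dj'.
have : ~~ odd (count (fun z : int => z < 0) (window j')).
  by move: Dj'; rewrite inE => /andP[].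
rewrite /ins_perm /ins_window; set j0 := take _ _.
have sz0 : size j0 = n.-1.
  by rewrite size_take_min size_window; apply/minn_idPl; rewrite leq_pred.
move=> ev un bd Ej; move: ev un bd; rewrite {}Ej.
have permI (q : nat) (z : int) l : perm_eq (take q l ++ z :: drop q l) (z :: l).
  by rewrite -cat1s perm_catCA /= perm_cons cat_take_drop.
rewrite map_rcons rcons_uniq all_rcons -cats1 count_cat => ev /andP[un1 un2] /andP[_ bd].
have sz (z : int) l : size l = n.-1 -> size (take p.2 l ++ z :: drop p.2 l) = n.
  by move=> sl; rewrite (perm_size (permI _ _ _)) /= sl prednK.
case: p.1; apply: of_windowP.
- by apply: sz; rewrite /= size_behead sz0; lia.
- rewrite (perm_all _ (permI _ _ _)).
  case: j0 sz0 bd {ev un1 un2} => [|a l] /=; first by lia.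
  by move=> _ /andP[a_bd ->]; rewrite !abszN a_bd absz_nat; lia.
- rewrite (perm_uniq (perm_map _ (permI _ _ _))).
  case: j0 sz0 un1 un2 {ev bd} => [|a l] /=; first by lia.
  by move=> _; rewrite !abszN !inE => -> /andP[-> ->].
- rewrite (seq.permP (permI _ _ _)).
  case: j0 sz0 ev bd {un1 un2} => [|a l] /=; first by lia.
  move=> _ ev /andP[a_bd _]; move: ev.
  have -> : (- n%:Z < 0) = true by lia.
  have -> : (- a < 0) = ~~ (a < 0) by lia.
  by case: (a < 0); rewrite /= ?addn0 ?add0n ?add1n /= ?negbK.
- exact: sz.
- by rewrite (perm_all _ (permI _ _ _)) /= bd andbT; lia.
- by rewrite (perm_uniq (perm_map _ (permI _ _ _))) /= un1.
- by rewrite (seq.permP (permI _ _ _)) /= addnC; move: ev; rewrite /= addn0.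
Qed.

(* Main.v *)
Require Import Defs.
From mathcomp Require Import all_boot all_order all_algebra all_fingroup.
From mathcomp Require Import zify.

Set Implicit Arguments.
Unset Strict Implicit.
Unset Printing Implicit Defensive.

Import Order.TTheory GRing.Theory Num.Theory.
Local Open Scope ring_scope.

(* Write [inverted w a b] when the values [a], [b] with |a| <> |b| occur in [w]
   in decreasing order.  Since [inverted (u o v) a b] is the exclusive or of
   [inverted u a b] and [inverted v (u^-1 a) (u^-1 b)], strong exchange gives that
   the weak order is inclusion of inversions, both in rank n and in rank n - 1, and
   that parabolic projection keeps exactly the inversions between values of
   absolute value < n.  So v >= u and v >= w iff the projection of v lies above
   [j'] and every k to the right of n in u or in w (a needed k) is to the right of
   n in v.  If p is maximal among the good positions, moving n from p to a next
   position q > p (there are two choices at p = -2) loses a needed value m; hence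
   each k to the right of n in [j^(p)] is, or stands to the right in [j'] of, such
   an m.  For m < k, the pair (m, k) is not inverted in [j'], hence neither in u
   nor in w, so k is needed as well; for k < m, the pair is inverted in [j'], hence
   in v, so k is to the right of n in v because m is.  Either way [j^(p)] <= v. *)

(** * Inversions and strong exchange *)

Section SignedPermutations.
Variable n : nat.
Implicit Types (a b x y : pm n) (u v w s t g : {perm pm n}).

Lemma pmNK : involutive (@pmN n).
Proof. by case=> b i; rewrite /pmN negbK. Qed.

Lemma eq_index x y : (x.2 == y.2) = (x == y) || (x == pmN y).
Proof. by case: x y => [[] i] [[] k]; rewrite /pmN /= !xpair_eqE /= ?orbF. Qed.

Lemma pmZ_ltNge a b : a != b -> (pmZ a < pmZ b) = ~~ (pmZ b < pmZ a).
Proof. by move=> ab; rewrite -leNgt lt_neqAle (inj_eq (@pmZ_inj n)) ab. Qed.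

Definition signed w := forall x, w (pmN x) = pmN (w x).

Lemma signed_index w a b : signed w -> ((w a).2 == (w b).2) = (a.2 == b.2).
Proof.
by move=> sw; rewrite !eq_index -sw !(inj_eq perm_inj).
Qed.

Lemma signedM u v : signed u -> signed v -> signed (u * v)%g.
Proof. by move=> su sv x; rewrite !permM su sv. Qed.

Lemma signedV u : signed u -> signed u^-1%g.
Proof. by move=> su x; apply: (@perm_inj _ u); rewrite su !permKV. Qed.

Lemma signed1 : signed 1%g.
Proof. by move=> x; rewrite !perm1. Qed.

Lemma stransC x y : strans x y = strans y x.
Proof. by rewrite /strans tpermC (tpermC x). Qed.

(** The two transpositions have disjoint supports, hence commute. *)
Lemma stransN x y : x.2 != y.2 -> strans (pmN x) (pmN y) = strans x y.
Proof.
rewrite eq_index negb_or => /andP[xy xNy]; rewrite /strans !pmNK [RHS]conjgC tpermJ.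
have neN z : (pmN z == z) = false by case: z => [[] k].
have yNx : y != pmN x by rewrite -(can2_eq pmNK pmNK) eq_sym.
have yxN : pmN y != x by rewrite eq_sym.
have xyN : pmN x != y by rewrite eq_sym.
by rewrite !tpermD // eq_sym ?neN.
Qed.

Lemma stransJ x y g : signed g -> (strans x y ^ g)%g = strans (g x) (g y).
Proof. by move=> sg; rewrite /strans conjMg !tpermJ !sg. Qed.

Lemma strans_l x y : x.2 != y.2 -> strans x y x = y.
Proof.
rewrite eq_index negb_or => /andP[xy xNy]; rewrite permM (@tpermD _ _ _ x) ?tpermL //.
  by case: (x) => [[] k].
by rewrite eq_sym.
Qed.

Lemma strans_r x y : x.2 != y.2 -> strans x y y = x.
Proof. by rewrite eq_sym stransC; apply: strans_l. Qed.

Lemma strans_id x y z : z.2 != x.2 -> z.2 != y.2 -> strans x y z = z.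
Proof.
rewrite !eq_index !negb_or => /andP[zx zNx] /andP[zy zNy].
by rewrite permM !tpermD // eq_sym.
Qed.

(** Negation is itself a signed permutation [N], and by [stransN] conjugation by it fixes
    [strans x y]. *)
Lemma strans_signed x y : x.2 != y.2 -> signed (strans x y).
Proof.
move=> xy z; pose N := perm (can_inj pmNK).
have sN : signed N by move=> c; rewrite !permE.
have NE c : N c = pmN c by rewrite permE.
have : (strans x y ^ N)%g = strans x y by rewrite stransJ // !NE stransN.
by move/permP/(_ (N z)); rewrite permJ !NE.
Qed.

Lemma stransK x y : x.2 != y.2 -> (strans x y * strans x y)%g = 1%g.
Proof.
move=> xy; rewrite -{1}stransN // {1}/strans !pmNK /strans -!mulgA (mulgA (tperm (pmN x) _)).
by rewrite tperm2 mul1g tperm2.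
Qed.

Lemma strans_pcompK x y w : x.2 != y.2 -> strans x y \oS (strans x y \oS w) = w.
Proof. by move=> xy; rewrite -[RHS]mulg1 -(stransK xy) [RHS]mulgA. Qed.

(* For [a.2 != b.2] this says that the reflection exchanging [a] and [b] is a
   left inversion of [w]; it is symmetric in [a] and [b]. *)
Definition inverted w a b : bool :=
  (pmZ a < pmZ b) (+) (pmZ (w^-1%g a) < pmZ (w^-1%g b)).

(** On the right the comparison of [u^-1 a] with [u^-1 b] occurs twice and cancels. *)
Lemma inverted_pcomp u v a b :
  inverted (u \oS v) a b = inverted v (u^-1%g a) (u^-1%g b) (+) inverted u a b.
Proof.
by rewrite /inverted /pcomp invMg !permM; do !case: (_ < _).
Qed.

Lemma inverted1 a b : inverted 1%g a b = false.
Proof. by rewrite /inverted invg1 !perm1 addbb. Qed.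

Lemma invertedC w a b : inverted w a b = inverted w b a.
Proof.
rewrite /inverted; have [->//|ab] := eqVneq a b.
rewrite (pmZ_ltNge ab) [X in _ (+) X = _]pmZ_ltNge ?(inj_eq perm_inj) //.
by rewrite addNb addbN negbK.
Qed.

Lemma invertedN w a b : signed w ->
  inverted w (pmN a) (pmN b) = inverted w a b.
Proof.
move=> /signedV sw; rewrite [RHS]invertedC /inverted !sw !pmZN.
by congr (_ (+) _); lia.
Qed.

Lemma inverted_strans a b : a.2 != b.2 -> inverted (strans a b) a b.
Proof.
move=> ab; have -> : inverted (strans a b) a b = (pmZ a < pmZ b) (+) (pmZ b < pmZ a).
  rewrite /inverted (_ : _^-1%g = strans a b) ?strans_l ?strans_r //.
  by apply: (mulgI (strans a b)); rewrite mulgV stransK.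
rewrite pmZ_ltNge; first by case: (_ < _).
by apply: contraNneq ab => ->.
Qed.

Lemma inverted_strans_pcomp w a b : a.2 != b.2 ->
  inverted (strans a b \oS w) a b = ~~ inverted w a b.
Proof.
move=> ab; rewrite inverted_pcomp inverted_strans // addbT.
rewrite (_ : _^-1%g = strans a b) ?strans_l ?strans_r //; first by rewrite invertedC.
by apply: (mulgI (strans a b)); rewrite mulgV stransK.
Qed.

(* The two properties of the simple reflections from which strong exchange
   follows: each is a reflection, and it inverts only its own root. *)
Definition reflection_system (S : {set {perm pm n}}) :=
  forall s, s \in S ->
    (exists x y, x.2 != y.2 /\ s = strans x y) /\
    (forall a b, a.2 != b.2 -> inverted s a b -> strans a b = s).

Section Exchange.
Variables (S : {set {perm pm n}}) (S_refl : reflection_system S).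

Lemma simple_signed s : s \in S -> signed s.
Proof. by case/S_refl=> [[x [y [xy ->]]] _]; apply: strans_signed. Qed.

Lemma generated_signed w : w \in <<S>>%g -> signed w.
Proof.
case/gen_prodgP=> k [c Sc ->]; apply: (@big_ind _ signed) => //.
- exact: signed1.
- exact: signedM.
- by move=> i _; apply: simple_signed.
Qed.

(** Induction on the word, peeling off the simple [s] applied last. If [s] inverts the pair, then
    [strans a b] is [s] and cancels it. Otherwise the pair pulled back by [s] is inverted in the
    rest, where the induction shortens the word, and conjugation by [s] carries the reflection
    over. *)
Lemma strong_exchange k w a b : w \in (S ^+ k)%g -> a.2 != b.2 ->
  inverted w a b ->
  [/\ (0 < k)%N, strans a b \oS w \in (S ^+ k.-1)%g & strans a b \in reflections S].
Proof.
elim: k w a b => [|k IHk] w a b.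
  by rewrite expg0 inE => /eqP-> _; rewrite inverted1.
rewrite expgSr => /mulsgP[v s vk Ss ->] ab; have [_ Dstrans] := S_refl Ss.
have sS := simple_signed Ss.
have -> : (v * s)%g = s \oS v by [].
rewrite inverted_pcomp; case Es: (inverted s a b) => /=.
  move=> _; have Et := Dstrans _ _ ab Es; split=> //.
    by rewrite -Et strans_pcompK.
  by rewrite Et; apply/imset2P; exists s 1%g => //; rewrite conjg1.
rewrite addbF => inv_v; have sSV := signedV sS.
have [|k_gt0 IH1 IH2] := IHk _ _ _ vk _ inv_v; first by rewrite signed_index.
rewrite -stransJ // in IH1 IH2; split=> //.
  have -> : strans a b \oS (s \oS v) = (((strans a b ^ s^-1) \oS v) * s)%g.
    by apply/permP=> x; rewrite !permM permKV invgK.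
  by rewrite -[k in (S ^+ k)%g](prednK k_gt0) expgSr mem_mulg.
case/imset2P: IH2 => r g Sr gS Er; apply/imset2P; exists r (g * s)%g => //.
  by rewrite groupM // mem_gen.
by rewrite conjgM -Er conjgKV.
Qed.

(** Multiplying by [strans a b] toggles the inversion, so strong exchange applied to the product
    gives the converse direction. *)
Lemma cox_length_strans w a b :
    w \in <<S>>%g -> a.2 != b.2 -> strans a b \in <<S>>%g ->
  (cox_length S (strans a b \oS w) < cox_length S w)%N = inverted w a b.
Proof.
have down v : v \in <<S>>%g -> a.2 != b.2 -> strans a b \in <<S>>%g ->
  inverted v a b -> (cox_length S (strans a b \oS v) < cox_length S v)%N.
- move=> vS ab tS inv_v; have [vk _] := cox_lengthP vS.
  have [l_gt0 tvk _] := strong_exchange vk ab inv_v.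
  have [_ /(_ _ tvk)] := cox_lengthP (groupM vS tS : strans a b \oS v \in _).
  by move=> le_l; rewrite (leq_ltn_trans le_l) // prednK.
move=> wS ab tS; case E: (inverted w a b); first exact: down.
apply/negbTE; rewrite -leqNgt ltnW //.
have /down : strans a b \oS w \in <<S>>%g by apply: groupM.
rewrite inverted_strans_pcomp // E => /(_ ab tS isT).
by rewrite strans_pcompK.
Qed.

Lemma weak_leP u w : u \in <<S>>%g -> w \in <<S>>%g -> reflect
  (forall a b, a.2 != b.2 -> strans a b \in <<S>>%g ->
     inverted u a b -> inverted w a b)
  (weak_le S u w).
Proof.
move=> uS wS; apply: (iffP subsetP) => [le_uw a b ab tS inv_u | inv_uw t].
  have [k [_ tk]] : exists k, strans a b \in <<S>>%g /\ strans a b \in (S ^+ k)%g.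
    by have [tk _] := cox_lengthP tS; exists (cox_length S (strans a b)).
  (* [strans a b] inverts its own pair, so exchange applied to it shows that it is conjugate to a
     generator. *)
  have [_ _ tR] := strong_exchange tk ab (inverted_strans ab).
  have := le_uw (strans a b); rewrite !inE tR !cox_length_strans //.
  exact.
rewrite !inE => /andP[tR]; rewrite tR /=; case/imset2P: tR => s g Ss gS ->.
have [[x [y [xy Es]]] _] := S_refl Ss; have sg := generated_signed gS.
have rS : strans (g x) (g y) \in <<S>>%g.
  by rewrite -stransJ // -Es groupJ // mem_gen.
rewrite Es stransJ // !cox_length_strans ?signed_index //.
by apply: inv_uw; rewrite ?signed_index.
Qed.

End Exchange.

End SignedPermutations.

(** * Even signed permutations *)

Section EvenSignedPermutations.
Variable n : nat.
Implicit Types (a b x y z : pm n) (u v w s t g : {perm pm n}) (i k : 'I_n).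

Lemma strans_inv x y : x.2 != y.2 -> (strans x y)^-1%g = strans x y.
Proof. by move=> xy; apply: (mulgI (strans x y)); rewrite mulgV stransK. Qed.

Lemma stransE x y z : x.2 != y.2 ->
  strans x y z =
    if z.2 == x.2 then (z.1 (+) x.1 (+) y.1, y.2)
    else if z.2 == y.2 then (z.1 (+) x.1 (+) y.1, x.2) else z.
Proof.
move=> xy; have sxy := strans_signed xy.
case: ifPn => [zx|zx]; last case: ifPn => [zy|zy]; last exact: strans_id.
- have [->|->] : z = x \/ z = pmN x.
    by move: zx; rewrite eq_index => /orP[/eqP|/eqP]; [left|right].
  + by rewrite strans_l // addbb; case: (y).
  + by rewrite sxy strans_l // /pmN /= addNb addbb; case: (y).
- have [->|->] : z = y \/ z = pmN y.
    by move: zy; rewrite eq_index => /orP[/eqP|/eqP]; [left|right].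
  + by rewrite strans_r // addbC addbA addbb; case: (x).
  + by rewrite sxy strans_r // /pmN /= addbC addbA addbN addbb; case: (x).
Qed.

Lemma ord_neq i k : val i <> val k -> i != k.
Proof. by move=> ik; apply: contra_notN ik => /eqP->. Qed.

Definition neg_parity w := \big[addb/false]_(i < n) (w (false, i)).1.

Lemma pmZ_lt0 x : (pmZ x < 0) = x.1.
Proof. by case: x => [[] i]; rewrite /pmZ /=; lia. Qed.

Lemma odd_negatives w :
  odd (count (fun z : int => z < 0) (window w)) = neg_parity w.
Proof.
rewrite count_map -sum1_count /neg_parity big_enum_cond /= big_mkcond.
rewrite (big_morph _ oddD (erefl : odd 0 = false)).
by apply: eq_bigr => i _; rewrite pmZ_lt0; case: (w _).1.
Qed.

Lemma SDP w : reflect (signed w /\ neg_parity w = false) (w \in SD n).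
Proof.
rewrite inE odd_negatives.
apply: (iffP andP) => [[/forallP sw /negbTE pw]|[sw ->]]; split=> //.
  by move=> x; apply/eqP.
by apply/forallP=> x; rewrite sw.
Qed.

(** The map [u] permutes absolute values, so the signs contributed by [v] are only reindexed. *)
Lemma neg_parityM u v : signed u -> signed v ->
  neg_parity (u * v)%g = neg_parity u (+) neg_parity v.
Proof.
move=> su sv; rewrite /neg_parity.
have inj_u : injective (fun i => (u (false, i)).2).
  by move=> i k /eqP; rewrite signed_index // => /eqP.
rewrite [X in _ (+) X](reindex_inj inj_u) -big_split; apply: eq_bigr => i _ /=.
rewrite permM; case: (u _) => [[] k] //=.
by rewrite -[(true, k)]/(pmN (false, k)) sv.
Qed.

Lemma neg_parity1 : neg_parity 1%g = false.
Proof. by apply: big1 => i _; rewrite perm1. Qed.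

(** Indices are zero-based: [m = n] gives [SD n] and [m = n.-1] gives [SDpar n], so one argument
    serves both ranks. *)
Definition SDle m : {set {perm pm n}} :=
  [set w in SD n | [forall x : pm n, (m <= x.2)%N ==> (w x == x)]].

Lemma SDleP m w : reflect
  [/\ signed w, neg_parity w = false & forall x, (m <= x.2)%N -> w x = x]
  (w \in SDle m).
Proof.
rewrite inE; apply: (iffP andP) => [[/SDP[sw pw] /forallP wm]|[sw pw wm]].
  by split=> // x mx; have := wm x; rewrite mx => /eqP.
split; first exact/SDP.
by apply/forallP=> x; apply/implyP=> mx; rewrite wm.
Qed.

Lemma SDle_group_set m : group_set (SDle m).
Proof.
apply/group_setP; split.
  apply/SDleP; split; [exact: signed1 | exact: neg_parity1 | ].
  by move=> x _; rewrite perm1.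
move=> u v /SDleP[su pu um] /SDleP[sv pv vm]; apply/SDleP; split.
- exact: signedM.
- by rewrite neg_parityM // pu pv.
- by move=> x mx; rewrite permM um // vm.
Qed.
Canonical SDle_group m := Group (SDle_group_set m).

Lemma neg_parity_strans x y : x.2 != y.2 -> neg_parity (strans x y) = false.
Proof.
move=> xy; rewrite /neg_parity (bigD1 x.2) //= (bigD1 y.2) 1?eq_sym //=.
rewrite !stransE //= !eqxx [y.2 == x.2]eq_sym (negbTE xy) /= addbA addbb /=.
by apply: big1 => l /andP[lx ly]; rewrite stransE //= (negbTE lx) (negbTE ly).
Qed.

Lemma SDle_lt m w x : w \in SDle m -> (x.2 < m)%N -> ((w x).2 < m)%N.
Proof.
case/SDleP=> _ _ w_fix; apply: contraTT; rewrite -!leqNgt => mwx.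
by have /perm_inj wx := w_fix _ mwx; rewrite -wx.
Qed.

End EvenSignedPermutations.

(** * Generation by simple reflections *)

Section Generation.
Variables (n : nat) (n_ge2 : (2 <= n)%N).
Implicit Types (a b x y z : pm n) (u v w s t g : {perm pm n}) (i k : 'I_n).

(** Trades the cyclic [ordS] and [ord_pred] of [sD] for a neighbour [i] given by an equation. *)
Variant sD_spec k : {perm pm n} -> Type :=
  | SDfirst i of k = 0%N :> nat & i = 1%N :> nat :
      sD_spec k (strans (false, k) (true, i))
  | SDnext i of i.+1 = k :> nat : sD_spec k (strans (false, i) (false, k)).

Lemma sDP k : sD_spec k (sD k).
Proof.
rewrite /sD; case: eqP => [k0|/eqP k_neq0].
  by apply: SDfirst => //=; rewrite k0 modn_small.
apply: SDnext => /=; have := ltn_ord k.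
by case: (val k) k_neq0 => // l _ ?; rewrite addSn /= modnDr modn_small // ltnW.
Qed.

Lemma sD_next i k : i.+1 = k :> nat -> sD k = strans (false, i) (false, k).
Proof.
move=> ik; case: sDP => [l k0|l lk]; first by rewrite k0 in ik.
by have -> : l = i by apply: val_inj; rewrite /=; lia.
Qed.

Lemma sD_first i k : k = 0%N :> nat -> i = 1%N :> nat ->
  sD k = strans (false, k) (true, i).
Proof.
move=> k0 i1; case: sDP => [l _ l1|l lk]; last by rewrite k0 in lk.
by have -> : l = i by apply: val_inj; rewrite /=; lia.
Qed.

Definition simpleDlt m : {set {perm pm n}} := [set sD k | k : 'I_n & (k < m)%N].

(** A case check on signs and indices. Distinct absolute values matter: the first generator also
    reverses the pairs -1, 1 and -2, 2, which belong to no reflection of type D. *)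
Lemma simpleDlt_reflections m : reflection_system (simpleDlt m).
Proof.
move=> _ /imsetP[k _ ->]; case: sDP => i.
- move=> k0 i1; have ki : k != i by apply: ord_neq; rewrite /= k0 i1.
  split=> [|[c p] [d q] /= pq]; first by exists (false, k), (true, i).
  rewrite /inverted strans_inv // !stransE //= => inv_s.
  have [[pk qi cd]|[pi qk cd]] :
    [/\ p = k, q = i & d = ~~ c] \/ [/\ p = i, q = k & d = ~~ c].
  + suff : p = k :> nat /\ q = i :> nat /\ d = ~~ c \/ p = i :> nat /\ q = k :> nat /\ d = ~~ c.
      by case=> [] [/val_inj-> [/val_inj-> ->]]; [left|right].
    move: pq inv_s; rewrite -!(inj_eq val_inj) /=.
    by case: c d => [] []; do !case: eqP => /= ?; rewrite /pmZ /=; lia.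
  + by rewrite {}pk {}qi {}cd; case: c {inv_s} => //; rewrite -stransN.
  + by rewrite {}pi {}qk {}cd stransC; case: c {inv_s} => //; rewrite -stransN.
- move=> ik; have ki : i != k by apply: ord_neq; rewrite /= -ik; lia.
  split=> [|[c p] [d q] /= pq]; first by exists (false, i), (false, k).
  rewrite /inverted strans_inv // !stransE //= => inv_s.
  have [[pk qi cd]|[pi qk cd]] :
    [/\ p = k, q = i & d = c] \/ [/\ p = i, q = k & d = c].
  + suff : p = k :> nat /\ q = i :> nat /\ d = c \/ p = i :> nat /\ q = k :> nat /\ d = c.
      by case=> [] [/val_inj-> [/val_inj-> ->]]; [left|right].
    move: pq inv_s; rewrite -!(inj_eq val_inj) /=.
    by case: c d => [] []; do !case: eqP => /= ?; rewrite /pmZ /=; lia.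
  + by rewrite {}pk {}qi {}cd stransC; case: c {inv_s} => //; rewrite -stransN.
  + by rewrite {}pi {}qk {}cd; case: c {inv_s} => //; rewrite -stransN.
Qed.

Lemma simpleDlt_SDle m : (2 <= m)%N -> simpleDlt m \subset SDle n m.
Proof.
move=> m_ge2; apply/subsetP=> s /imsetP[k]; rewrite inE => lt_km ->.
case: sDP => i.
- move=> k0 i1; have ki : k != i by apply: ord_neq; rewrite /= k0 i1.
  apply/SDleP; split; first exact: strans_signed.
    exact: neg_parity_strans.
  move=> x mx; rewrite stransE //= -!(inj_eq val_inj) /=.
  by do !case: eqP => //; lia.
- move=> ik; have ki : i != k by apply: ord_neq; rewrite /= -ik; lia.
  apply/SDleP; split; first exact: strans_signed.
    exact: neg_parity_strans.
  move=> x mx; rewrite stransE //= -!(inj_eq val_inj) /=.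
  by do !case: eqP => //; lia.
Qed.

Lemma generated_SDle m : (2 <= m)%N -> <<simpleDlt m>>%g \subset SDle n m.
Proof. by move=> m_ge2; rewrite gen_subG simpleDlt_SDle. Qed.

Definition no_simple_inversion m w :=
  (forall i k, i.+1 = k :> nat -> (k < m)%N ->
     inverted w (false, i) (false, k) = false) /\
  (forall i k, i = 0%N :> nat -> k = 1%N :> nat ->
     inverted w (false, i) (true, k) = false).

Section NoSimpleInversion.
Variables (m : nat) (w : {perm pm n}).
Hypotheses (m_ge2 : (2 <= m)%N) (sw : signed w).
Let h i : int := pmZ (w^-1%g (false, i)).
Hypothesis w_simple : no_simple_inversion m w.

Let h_lt i k : (k < m)%N -> i.+1 = k :> nat -> h i < h k.
Proof.
move=> km ik; have [/(_ i k ik km) + _] := w_simple.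
rewrite /inverted -/(h i) -/(h k).
by move: (h i) (h k) => p q; rewrite /pmZ /=; lia.
Qed.

Let h01_gt0 i k : i = 0%N :> nat -> k = 1%N :> nat -> 0 < h i + h k.
Proof.
move=> i0 k1; have [_ /(_ i k i0 k1)] := w_simple.
have -> : (true, k) = pmN (false, k) by [].
rewrite invertedC /inverted (signedV sw) (pmZN (w^-1%g _)) -/(h i) -/(h k).
by move: (h i) (h k) => p q; rewrite /pmZ /= /pmN /=; lia.
Qed.

Lemma no_simple_inversion_increasing i k : (i < k)%N -> (k < m)%N -> h i < h k.
Proof.
move=> ik km; have [d kd] : exists d, k = (i + d.+1)%N :> nat by exists (k - i).-1; lia.
elim: d k ik km kd => [|d IHd] k ik km kd; first by apply: h_lt => //; rewrite kd addn1.
have kp : (k.-1 < n)%N by have := ltn_ord k; lia.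
apply: (@lt_trans _ _ (h (Ordinal kp))); first by apply: IHd => /=; lia.
by apply: h_lt => //=; lia.
Qed.

(** As [h] increases, the smallest such sum is the one at indices 0 and 1, positive because 1 and -2
    are not inverted. *)
Lemma no_simple_inversion_pos i k : (i < k)%N -> (k < m)%N -> 0 < h i + h k.
Proof.
move=> ik km; have n0 : (0 < n)%N by lia.
have := @h01_gt0 (Ordinal n0) (Ordinal n_ge2) erefl erefl.
have h0 : h (Ordinal n0) <= h i.
  have [i0|i_gt0] := posnP i; last by rewrite ltW // no_simple_inversion_increasing //=; lia.
  by rewrite (_ : Ordinal n0 = i) //; apply: val_inj.
have h1 : h (Ordinal n_ge2) <= h k.
  have [k_gt1|k_le1] := ltnP 1 k; first by rewrite ltW // no_simple_inversion_increasing.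
  by rewrite (_ : Ordinal n_ge2 = k) //; apply: val_inj => /=; lia.
by lia.
Qed.

Lemma no_simple_inversionP a b : (a.2 < m)%N -> (b.2 < m)%N -> a.2 != b.2 ->
  inverted w a b = false.
Proof.
have sE c i : pmZ (w^-1%g (c, i)) = if c then - h i else h i.
  by case: c => //; rewrite -[(true, i)]/(pmN (false, i)) (signedV sw) pmZN.
wlog ab : a b / (a.2 < b.2)%N.
  move=> IH am bm; rewrite neq_ltn => /orP[ab|ba].
    by apply: IH => //; rewrite neq_ltn ab.
  by rewrite invertedC; apply: IH => //; rewrite neq_ltn ba.
case: a b ab => [c i] [d k] /= ik im km _; rewrite /inverted !sE.
have := no_simple_inversion_increasing ik km; have := no_simple_inversion_pos ik km.
by rewrite /pmZ /=; case: c d => [] [] /=; lia.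
Qed.

End NoSimpleInversion.

(* A potential that strictly grows when a simple inversion is removed. *)
Definition weight w : int := \sum_(i < n) i%:Z * pmZ (w^-1%g (false, i)).

(** The entries at [i] and [k] are swapped and their coefficients differ by one, so the weight grows
    by the difference of the entries. *)
Lemma weight_next v i k : i.+1 = k :> nat -> inverted v (false, i) (false, k) ->
  weight v < weight (sD k \oS v).
Proof.
move=> ik; have ki : i != k by apply: ord_neq; rewrite /= -ik; lia.
rewrite invertedC /inverted (sD_next ik) /weight => inv_v.
rewrite (bigD1 i) // (bigD1 k) 1?eq_sym //= [ltRHS](bigD1 i) // [in ltRHS](bigD1 k) 1?eq_sym //=.
under [in ltRHS]eq_bigr => l /andP[li lk].
  rewrite /pcomp invMg permM strans_inv // (stransE (false, l)) //= (negbTE li) (negbTE lk); over.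
rewrite /pcomp invMg !permM strans_inv // !stransE //= eqxx [k == i]eq_sym (negbTE ki) eqxx.
move: inv_v; rewrite ?sE ?pmZN; move: (\sum_(_ | _) _) => r; move: (pmZ (v^-1%g _)) (pmZ (v^-1%g _)) => p q.
by rewrite /pmZ /= -ik; lia.
Qed.

(** The entry at [k] has coefficient 0; the one at [i], of coefficient 1, is replaced by the
    opposite of the entry at [k], which is larger. *)
Lemma weight_first v i k : signed v -> k = 0%N :> nat -> i = 1%N :> nat ->
  inverted v (false, k) (true, i) -> weight v < weight (sD k \oS v).
Proof.
move=> sv k0 i1; have ki : k != i by apply: ord_neq; rewrite /= k0 i1.
rewrite /inverted (sD_first k0 i1) /weight => inv_v.
rewrite (bigD1 i) // (bigD1 k) //= [ltRHS](bigD1 i) // [in ltRHS](bigD1 k) //=.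
under [in ltRHS]eq_bigr => l /andP[li lk].
  rewrite /pcomp invMg permM strans_inv // (stransE (false, l)) //= (negbTE li) (negbTE lk); over.
rewrite /pcomp invMg !permM strans_inv // !stransE //= !eqxx [i == k]eq_sym (negbTE ki) /=.
have sE l : v^-1%g (true, l) = pmN (v^-1%g (false, l)) by rewrite -(signedV sv).
rewrite !sE !pmZN.
move: inv_v; rewrite ?sE ?pmZN; move: (\sum_(_ | _) _) => r; move: (pmZ (v^-1%g _)) (pmZ (v^-1%g _)) => p q.
by rewrite /pmZ /= k0 i1; lia.
Qed.

(** Take [g] of maximal weight: a remaining simple inversion could be removed within the group,
    raising the weight. *)
Lemma coset_minimal m w : (2 <= m)%N -> signed w ->
  exists2 g, g \in <<simpleDlt m>>%g &
    forall a b, (a.2 < m)%N -> (b.2 < m)%N -> a.2 != b.2 ->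
      inverted (g \oS w) a b = false.
Proof.
move=> m_ge2 sw; have S_refl := @simpleDlt_reflections m.
have S1 : 1%g \in <<simpleDlt m>>%g by apply: group1.
case: (Order.TotalTheory.arg_maxP (fun g => weight (g \oS w)) S1) => g gS g_max.
exists g => // a b am bm ab.
have sgw : signed (g \oS w) by apply: signedM => //; apply: generated_signed gS.
apply: no_simple_inversionP am bm ab => //.
have maxS k : (k < m)%N -> ~~ (weight (g \oS w) < weight (sD k \oS (g \oS w))).
  move=> km; rewrite -leNgt (_ : sD k \oS (g \oS w) = (sD k \oS g) \oS w).
    by apply: g_max; apply: (groupM gS); apply: mem_gen; apply/imsetP; exists k; rewrite ?inE.
  by apply/permP=> x; rewrite !pcompE.
split=> [i k ik km | i k i0 k1]; apply: contraNF (maxS _ _).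
- exact: weight_next.
- exact: km.
- exact: weight_first.
- by rewrite i0; lia.
Qed.

(** The inverse [v] preserves the order of values of distinct absolute value. This makes every
    window entry but the first positive, parity settles the first, and an increasing map of the
    first [m] indices to themselves is the identity. *)
Lemma SDle_no_inversion m w : (2 <= m)%N -> (m <= n)%N -> w \in SDle n m ->
    (forall a b, (a.2 < m)%N -> (b.2 < m)%N -> a.2 != b.2 ->
       inverted w a b = false) ->
  w = 1%g.
Proof.
move=> m_ge2 le_mn Ww no_inv.
have /SDleP[sV pV fixV] : w^-1%g \in SDle n m by rewrite groupV.
set v := w^-1%g in sV pV fixV.
have n_gt0 : (0 < n)%N by lia.
have vm x : (x.2 < m)%N -> ((v x).2 < m)%N by apply: SDle_lt; rewrite groupV.
have lt_v a b : (a.2 < m)%N -> (b.2 < m)%N -> a.2 != b.2 ->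
    pmZ a < pmZ b -> pmZ (v a) < pmZ (v b).
  by move=> am bm ab lt_ab; have := no_inv a b am bm ab; rewrite /inverted lt_ab => /negbFE.
have pos1 i : (0 < i)%N -> (v (false, i)).1 = false.
  move=> i_gt0; have [lt_im|le_mi] := ltnP i m; last by rewrite fixV.
  have oi : Ordinal n_gt0 != i by rewrite -(inj_eq val_inj) /= neq_ltn i_gt0.
  (* Both 1 and -1 lie below [i + 1], so [v] sends the latter above two opposite integers. *)
  have H1 := @lt_v (false, Ordinal n_gt0) (false, i) ltac:(rewrite /=; lia) lt_im oi ltac:(rewrite /pmZ /=; lia).
  have H2 := @lt_v (true, Ordinal n_gt0) (false, i) ltac:(rewrite /=; lia) lt_im oi ltac:(rewrite /pmZ /=; lia).
  move: H1 H2; rewrite -[(true, _)]/(pmN (false, Ordinal n_gt0)) sV pmZN.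
  by rewrite -pmZ_lt0; lia.
have pos i : (v (false, i)).1 = false.
  have [i0|i_gt0] := posnP i; last exact: pos1.
  move: pV; rewrite /neg_parity (bigD1 i) //= big1 ?addbF // => k ki.
  by apply: pos1; rewrite lt0n -i0 (inj_eq val_inj).
pose f i := (v (false, i)).2.
have vE i : v (false, i) = (false, f i) by rewrite [LHS]surjective_pairing pos.
have f_gap d i k : (i + d)%N = k :> nat -> (k < m)%N -> (f i + d <= f k)%N.
  elim: d k => [|d IHd] k ik km.
    by rewrite addn0 (_ : i = k) //; apply: val_inj; rewrite /= -ik addn0.
  have kp : (k.-1 < n)%N by have := ltn_ord k; lia.
  have := IHd (Ordinal kp) ltac:(rewrite /=; lia) ltac:(rewrite /=; lia).
  have pk : Ordinal kp != k by rewrite -(inj_eq val_inj) /=; lia.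
  have := @lt_v (false, Ordinal kp) (false, k) ltac:(rewrite /=; lia) km pk ltac:(rewrite /pmZ /=; lia).
  by rewrite !vE /pmZ /=; lia.
have f_id i : f i = i.
  have [lt_im|le_mi] := ltnP i m; last by rewrite /f fixV.
  have pm : (m.-1 < n)%N by lia.
  (* Counting gaps up from index 0 bounds [f i] below; counting up to index [m.-1] bounds it
     above. *)
  have H1 := @f_gap i (Ordinal n_gt0) i (add0n i) lt_im.
  have H2 := @f_gap (m.-1 - i)%N i (Ordinal pm) ltac:(rewrite /=; lia) ltac:(rewrite /=; lia).
  have /= H3 := vm (false, Ordinal pm) ltac:(rewrite /=; lia).
  by apply: val_inj; move: H1 H2 H3; rewrite -/(f _) /=; lia.
apply: invg_inj; rewrite invg1 -/v; apply/permP=> -[c i]; rewrite perm1.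
case: c; last by rewrite vE f_id.
by rewrite -[(true, i)]/(pmN (false, i)) sV vE f_id.
Qed.

Lemma generated_simpleDlt m : (2 <= m)%N -> (m <= n)%N ->
  <<simpleDlt m>>%g = SDle n m.
Proof.
move=> m_ge2 le_mn; apply/eqP; rewrite eqEsubset generated_SDle //=.
apply/subsetP=> w Ww; have /SDleP[sw _ _] := Ww.
have [g gS no_inv] := coset_minimal m_ge2 sw.
have gW := subsetP (generated_SDle m_ge2) _ gS.
have wg : (w * g)%g = 1%g by apply: SDle_no_inversion (groupM Ww gW) no_inv.
by rewrite -(mulgK g w) wg mul1g groupV.
Qed.

(** [strans a b] lies in [SDle n m] exactly when both indices are below [m], which turns membership
    of the reflection into bounds. *)
Lemma weak_le_SDle m u w : (2 <= m)%N -> (m <= n)%N ->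
    u \in SDle n m -> w \in SDle n m -> reflect
  (forall a b, (a.2 < m)%N -> (b.2 < m)%N -> a.2 != b.2 ->
     inverted u a b -> inverted w a b)
  (weak_le (simpleDlt m) u w).
Proof.
move=> m_ge2 le_mn uW wW; have gE := generated_simpleDlt m_ge2 le_mn.
have S_refl := @simpleDlt_reflections m.
apply: (iffP (weak_leP S_refl _ _)); rewrite ?gE // => le_uw a b.
  move=> am bm ab; apply: le_uw => //; apply/SDleP; split.
  - exact: strans_signed.
  - exact: neg_parity_strans.
  - move=> x mx; apply: strans_id; rewrite neq_ltn; apply/orP; right; exact: leq_trans mx.
move=> ab /SDleP[_ _ fix_t]; apply: le_uw => //; rewrite ltnNge; apply/negP=> mx.
- by have := fix_t a mx; rewrite strans_l // => E; rewrite E eqxx in ab.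
- by have := fix_t b mx; rewrite strans_r // => E; rewrite E eqxx in ab.
Qed.

End Generation.

(** * Parabolic projections and insertions *)

Section Insertion.
Variables (n : nat) (n_ge3 : (3 <= n)%N).
Implicit Types (a b x y z p q : pm n) (u v w s g : {perm pm n}) (i k : 'I_n).

Let n_ge2 : (2 <= n)%N := ltnW n_ge3.
Let m_ge2 : (2 <= n.-1)%N. Proof. by lia. Qed.
Let le_mn : (n.-1 <= n)%N := leq_pred n.

Lemma SD_SDle : SD n = SDle n n.
Proof.
apply/setP=> w; rewrite [RHS]inE; case: (w \in _) => //=; symmetry.
by apply/forallP=> x; rewrite leqNgt ltn_ord.
Qed.

Lemma SDpar_SDle : SDpar n = SDle n n.-1.
Proof.
apply/setP=> w; rewrite [LHS]inE [RHS]inE; case: SDP => //= -[sw _].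
have posE i : (n.-1 <= i)%N = (pmZ (false, i) == n%:Z).
  by rewrite /pmZ /=; have := ltn_ord i; lia.
apply/forallP/forallP=> w_fix [c i]; apply/implyP=> /= in_x.
  have /implyP := w_fix (false, i); rewrite -posE => /(_ in_x)/eqP E.
  by case: c; rewrite ?E //; rewrite -[(true, i)]/(pmN (false, i)) sw E.
have /implyP := w_fix (c, i); apply; move: in_x.
by rewrite /pmZ /=; case: c; have := ltn_ord i; lia.
Qed.

Lemma simpleD_simpleDlt : simpleD n = simpleDlt n n.
Proof.
by apply/setP=> s; apply/imsetP/imsetP=> -[k _ ->]; exists k; rewrite ?inE.
Qed.

Lemma simpleDpar_simpleDlt : simpleDpar n = simpleDlt n n.-1.
Proof.
by apply/setP=> s; apply/imsetP/imsetP=> -[k + ->]; rewrite inE => lt_k;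
  exists k; rewrite ?inE //; lia.
Qed.

Lemma inverted_parabolic_factor m g v : g \in SDle n m ->
    (forall a b, (a.2 < m)%N -> (b.2 < m)%N -> a.2 != b.2 ->
       inverted v a b = false) ->
  forall a b, (a.2 < m)%N -> (b.2 < m)%N -> a.2 != b.2 ->
    inverted (g \oS v) a b = inverted g a b.
Proof.
rewrite -groupV => gW no_inv a b am bm ab; have [sg _ _] := SDleP _ _ gW.
by rewrite inverted_pcomp no_inv ?(SDle_lt gW) ?signed_index.
Qed.

(** By [cox_length_strans] the length condition says that [v] has no simple inversion of rank
    [n.-1], hence none between small values; the factor [wI] carries them all. *)
Lemma parproj_inverted w wI : w \in SD n -> is_parproj w wI ->
  wI \in SDle n n.-1 /\
  forall a b, (a.2 < n.-1)%N -> (b.2 < n.-1)%N -> a.2 != b.2 ->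
    inverted wI a b = inverted w a b.
Proof.
move=> _ [wI_par [v [v_SD -> v_min]]]; rewrite SDpar_SDle in wI_par; split=> // a b am bm ab.
have [sv _] := SDP _ v_SD.
have no_desc k x y : (k < n.-1)%N -> x.2 != y.2 -> sD k = strans x y ->
    inverted v x y = false.
  move=> km xy Ek; have Sk : sD k \in simpleDlt n n by apply/imsetP; exists k; rewrite ?inE.
  have /v_min : sD k \in simpleDpar n by rewrite simpleDpar_simpleDlt; apply/imsetP; exists k; rewrite ?inE.
  rewrite simpleD_simpleDlt => lt_v; apply/negP=> inv_v.
  have := cox_length_strans (@simpleDlt_reflections _ n_ge2 n) (w := v) _ xy.
  rewrite -Ek generated_simpleDlt // -SD_SDle inv_v => /(_ v_SD).
  rewrite SD_SDle (subsetP (simpleDlt_SDle n_ge2 n_ge2)) // => /(_ isT).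
  by rewrite ltnNge ltnW.
symmetry; apply: (inverted_parabolic_factor wI_par _ am bm ab) => c d.
apply: no_simple_inversionP => //.
split=> [i k ik km|i k i0 k1].
  by apply: no_desc km _ (sD_next n_ge2 ik); apply: ord_neq; rewrite /= -ik; lia.
apply: (no_desc i) (sD_first n_ge2 i0 k1); first by rewrite i0; lia.
by apply: ord_neq; rewrite /= i0 k1.
Qed.

(** Provides the projection of an arbitrary upper bound, of which only the inversions matter. *)
Lemma exists_parabolic_component w : w \in SD n ->
  exists2 wI, wI \in SDle n n.-1 &
    forall a b, (a.2 < n.-1)%N -> (b.2 < n.-1)%N -> a.2 != b.2 ->
      inverted wI a b = inverted w a b.
Proof.
case/SDP=> sw _; have [g gS no_inv] := coset_minimal n_ge2 m_ge2 sw.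
have gW := subsetP (generated_SDle n_ge2 m_ge2) _ gS.
exists g^-1%g; first by rewrite groupV.
move=> a b am bm ab; rewrite -(inverted_parabolic_factor _ no_inv) ?groupV //.
by congr inverted; apply/permP=> x; rewrite !pcompE permK.
Qed.

Lemma last_subproof : (n.-1 < n)%N. Proof. by lia. Qed.
Definition top : pm n := (false, Ordinal last_subproof).

(** Pairs involving -n reduce to pairs involving n by negating both members. *)
Lemma weak_le_top u w : u \in SD n -> w \in SD n ->
    (forall a b, (a.2 < n.-1)%N -> (b.2 < n.-1)%N -> a.2 != b.2 ->
       inverted u a b -> inverted w a b) ->
    (forall a, (a.2 < n.-1)%N -> inverted u a top -> inverted w a top) ->
  weak_le (simpleD n) u w.
Proof.
rewrite simpleD_simpleDlt SD_SDle => uW wW le_I le_top.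
have [[su _ _] [sw _ _]] := (SDleP _ _ uW, SDleP _ _ wW).
apply/weak_le_SDle=> // a b _ _.
have topP x : ~~ (x.2 < n.-1)%N -> x = top \/ x = pmN top.
  case: x => c i /= im; have -> : i = Ordinal last_subproof.
    by apply: val_inj; rewrite /=; have := ltn_ord i; lia.
  by case: c; [right|left].
have le_topN x : (x.2 < n.-1)%N -> inverted u x (pmN top) -> inverted w x (pmN top).
  by move=> xm; rewrite -(pmNK x) !invertedN //; apply: le_top.
case: (boolP (a.2 < n.-1)%N) => [am|/topP a_top];
  case: (boolP (b.2 < n.-1)%N) => [bm|/topP b_top] ab.
- exact: le_I.
- by case: b_top => ->; [apply: le_top | apply: le_topN].
- by case: a_top => ->; rewrite invertedC [inverted w _ _]invertedC;
    [apply: le_top | apply: le_topN].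
- by case/negP: ab; case: a_top => ->; case: b_top => ->.
Qed.

Lemma weak_le_inverted u w a b : u \in SD n -> w \in SD n ->
  weak_le (simpleD n) u w -> a.2 != b.2 -> inverted u a b -> inverted w a b.
Proof.
rewrite simpleD_simpleDlt SD_SDle => uW wW /weak_le_SDle le_uw.
by apply: le_uw => //; rewrite ltn_ord.
Qed.

(** * Complete notation and the values to the right of n *)

Definition position_order : seq (pm n) :=
  [seq (true, i) | i <- rev (enum 'I_n)] ++ [seq (false, i) | i <- enum 'I_n].

Lemma complete_position_order w : signed w ->
  complete w = [seq pmZ (w y) | y <- position_order].
Proof.
move=> sw; rewrite /complete /window -map_rev -map_comp /position_order map_cat -!map_comp.
congr (_ ++ _); apply: eq_map => i /=.
by rewrite -[(true, i)]/(pmN (false, i)) sw pmZN.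
Qed.

(** The list is strictly increasing under [pmZ] and contains every signed position. *)
Lemma index_position_order x y :
  (index x position_order < index y position_order)%N = (pmZ x < pmZ y).
Proof.
have mem_L z : z \in position_order.
  by case: z => [[] i]; rewrite mem_cat map_f ?orbT ?mem_rev ?mem_enum.
pose r : rel (pm n) := fun a b => pmZ a < pmZ b.
have r_trans : transitive r by move=> b a c; apply: lt_trans.
have enum_sorted : sorted (fun i k => (i < k)%N) (enum 'I_n).
  by have := iota_ltn_sorted 0 n; rewrite -val_enum_ord sorted_map.
have L_sorted : sorted r position_order.
  rewrite /position_order; move: (enum 'I_n) enum_sorted => e e_sorted.
  rewrite sorted_pairwise // pairwise_cat !pairwise_map.
  have tr : transitive (fun i k => (i < k)%N) by move=> k i l; apply: ltn_trans.
  apply/and3P; split.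
  - apply/allrelP=> _ _ /mapP[i _ ->] /mapP[k _ ->].
    by rewrite /r /pmZ /=; lia.
  - rewrite -sorted_pairwise ?rev_sorted; last by move=> k i l; apply: lt_trans.
    apply: sub_sorted e_sorted => i k.
    by rewrite /r /pmZ /=; lia.
  - rewrite -sorted_pairwise; last by move=> k i l; apply: lt_trans.
    apply: sub_sorted e_sorted => i k.
    by rewrite /r /pmZ /=; lia.
have lt_index := sorted_ltn_index r_trans L_sorted.
apply/idP/idP=> [|xy]; first exact: lt_index.
rewrite ltnNge leq_eqVlt; apply/norP; split.
  apply: contraTneq xy => /(congr1 (nth x position_order)).
  by rewrite !nth_index // => ->; rewrite ltxx.
apply: contraTN xy => /lt_index lt_yx.
by rewrite -leNgt ltW //; apply: lt_yx.
Qed.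

(** The value of [x] is below n, so being inverted means that n comes first. *)
Lemma inverted_top w x : (x.2 < n.-1)%N ->
  inverted w x top = (pmZ (w^-1%g top) < pmZ (w^-1%g x)).
Proof.
move=> xm; have xtop : x != top by apply: contraTneq xm => ->; rewrite ltnn.
have -> : inverted w x top = ~~ (pmZ (w^-1%g x) < pmZ (w^-1%g top)).
  rewrite /inverted -addTb; congr (_ (+) _).
  by case: x xm {xtop} => [[] i]; rewrite /pmZ /=; lia.
by rewrite -pmZ_ltNge // (inj_eq perm_inj) eq_sym.
Qed.

Lemma right_of_nE w x : signed w -> (x.2 < n.-1)%N ->
  right_of_n w (pmZ x) = inverted w x top.
Proof.
move=> sw xm.
have inj_w : injective (fun y => pmZ (w y)).
  by move=> y z /pmZ_inj/perm_inj.
have indexE y : index (pmZ y) (complete w) = index (w^-1%g y) position_order.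
  by rewrite complete_position_order // -{1}(permKV w y) (index_map inj_w).
have nE : n%:Z = pmZ top by rewrite /pmZ /=; lia.
by rewrite /right_of_n nE !indexE index_position_order inverted_top.
Qed.

Lemma pmZ_onto (k : int) : (0 < `|k| <= n)%N -> exists x : pm n, pmZ x = k.
Proof.
case/andP=> k_gt0 k_le; have lt_k : (`|k|.-1 < n)%N by lia.
by exists (k < 0, Ordinal lt_k); rewrite /pmZ /=; case: ifP; lia.
Qed.

Lemma right_of_n_forall (P : int -> Prop) :
  (forall k : int, (0 < `|k| < n)%N -> P k) <->
  (forall x, (x.2 < n.-1)%N -> P (pmZ x)).
Proof.
split=> P_all => [x xm | k /andP[k_gt0 k_lt]].
  by apply: P_all; rewrite /pmZ; case: x.1; lia.
have [x xk] : exists x : pm n, pmZ x = k by apply: pmZ_onto; lia.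
rewrite -xk; apply: P_all; move: xk k_lt.
by rewrite /pmZ; case: x.1; lia.
Qed.

(** * Positions of values after an insertion *)

Lemma nth_insert (s : seq int) (l j : nat) (z : int) : (l <= size s)%N ->
  nth 0 (take l s ++ z :: drop l s) j =
    if (j < l)%N then nth 0 s j else if j == l then z else nth 0 s j.-1.
Proof.
move=> le_l; rewrite nth_cat size_takel //; case: ltnP => [lt_jl|le_lj].
  by rewrite nth_take.
case: eqP => [->|/eqP neq_jl]; first by rewrite subnn.
have -> : (j - l = (j.-1 - l).+1)%N by lia.
by rewrite /= nth_drop; congr nth; lia.
Qed.

(* The position of [ins_perm j' p] holding the value at position [y] of [j']. *)
Definition shift p y : pm n :=
  (y.1 (+) (p.1 && (y.2 == 0%N :> nat)),
   if (y.2 < p.2)%N then y.2 else ordS y.2).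

Lemma ordS_val i : (i < n.-1)%N -> ordS i = i.+1 :> nat.
Proof. by move=> im; rewrite /= modn_small //; lia. Qed.

Section InsertionInverse.
Variables (j' : {perm pm n}) (j'W : j' \in SDle n n.-1).
Implicit Types (J : {perm pm n}).

Let sj : signed j'. Proof. by have [] := SDleP _ _ j'W. Qed.

Lemma ins_perm_SD p : ins_perm j' p \in SD n.
Proof. by move: j'W; rewrite -SDpar_SDle => /(ins_permP p n_ge2)[]. Qed.

Lemma pmZ_ins_perm p i :
  pmZ (ins_perm j' p (false, i)) =
    if i == p.2 then if p.1 then - n%:Z else n%:Z else
    let l := if (i < p.2)%N then i : nat else i.-1 in
    (-1) ^+ (p.1 && (l == 0%N)) * nth 0 (window j') l.
Proof.
have winE : window (ins_perm j' p) = ins_window j' p.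
  by move: j'W; rewrite -SDpar_SDle => /(ins_permP p n_ge2)[].
rewrite -nth_window winE /ins_window; set j0 := take n.-1 _.
have sz0 : size j0 = n.-1 by rewrite size_takel ?size_window ?leq_pred.
have win0 l : (l < n.-1)%N -> nth 0 j0 l = nth 0 (window j') l by move=> ?; rewrite nth_take.
have := ltn_ord i; have := ltn_ord p.2; rewrite -(inj_eq val_inj) /= => lt_p lt_i.
case: p.1 => /=; last first.
  rewrite nth_insert ?sz0; last by lia.
  case: eqP => [->|ip]; first by rewrite ltnn.
  by case: ltnP => ? /=; rewrite expr0 mul1r win0 //; lia.
rewrite nth_insert /= ?size_behead ?sz0; last by lia.
have nth1 l : (l < n.-1)%N -> nth 0 (- head 0 j0 :: behead j0) l =
    (-1) ^+ (l == 0%N) * nth 0 (window j') l.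
  move=> lm; rewrite -win0 //; case: l lm => [|l] lm /=; last by rewrite mul1r nth_behead.
  by rewrite expr1 mulN1r -nth0.
case: eqP => [->|ip]; first by rewrite ltnn.
by case: ltnP => ?; rewrite nth1 //; lia.
Qed.

Lemma ins_perm_top p : ins_perm j' p p = top.
Proof.
have [sJ _] := SDP _ (ins_perm_SD p).
have E : ins_perm j' p (false, p.2) = (p.1, Ordinal last_subproof).
  by apply: pmZ_inj; rewrite pmZ_ins_perm eqxx /pmZ /=; case: p.1; lia.
case: p E sJ => -[] q /= E sJ //.
by rewrite -[X in _ X = _]/(pmN (false, q)) sJ E.
Qed.

Lemma ins_perm_shift p y : (y.2 < n.-1)%N -> ins_perm j' p (shift p y) = j' y.
Proof.
have [sJ _] := SDP _ (ins_perm_SD p).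
wlog yE : y / y.1 = false.
  move=> IH; case: y => -[] i im; last exact: IH.
  have -> : shift p (true, i) = pmN (shift p (false, i)).
    by rewrite /shift /pmN /=; case: (_ && _).
  by rewrite sJ IH // -sj.
case: y yE => c i /= -> im; apply: pmZ_inj.
have sE c' l : pmZ (ins_perm j' p (c', l)) = (-1) ^+ c' * pmZ (ins_perm j' p (false, l)).
  case: c'; last by rewrite mul1r.
  by rewrite -[(true, l)]/(pmN (false, l)) sJ pmZN mulN1r.
rewrite /shift /=; set l : 'I_n := (if _ then i else ordS i).
rewrite sE pmZ_ins_perm -(inj_eq val_inj) /=.
have lE : l = (if (i < p.2)%N then i : nat else i.+1) :> nat.
  by rewrite /l; case: ifP => _ //; rewrite ordS_val.
have lp : (l == p.2 :> nat) = false by rewrite lE; case: ltnP; lia.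
have -> : (if (l < p.2)%N then l : nat else l.-1) = i.
  by rewrite lE; case: (ltnP i p.2) => [->//|le_p]; rewrite ltnNge (leqW le_p).
(* The sign in [shift] and the flip of the first entry coincide, so their product is a square. *)
by rewrite lp mulrA -expr2 sqrr_sign mul1r nth_window.
Qed.

Lemma ins_perm_inv_top p : (ins_perm j' p)^-1%g top = p.
Proof. by rewrite -(ins_perm_top p) permK. Qed.

Lemma ins_perm_inv p a : (a.2 < n.-1)%N ->
  (ins_perm j' p)^-1%g a = shift p (j'^-1%g a).
Proof.
move=> am; have jam : ((j'^-1%g a).2 < n.-1)%N by apply: SDle_lt; rewrite ?groupV.
by apply: (@perm_inj _ (ins_perm j' p)); rewrite ins_perm_shift // !permKV.
Qed.

(** [shift p] keeps the order of positions of distinct absolute value: it preserves the order of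
    absolute values, and only the smallest one may change sign. *)
Lemma inverted_ins_perm p a b : (a.2 < n.-1)%N -> (b.2 < n.-1)%N -> a.2 != b.2 ->
  inverted (ins_perm j' p) a b = inverted j' a b.
Proof.
move=> am bm ab; rewrite /inverted !ins_perm_inv //; congr (_ (+) _).
have sjV := signedV sj; move: ab; rewrite -(signed_index _ _ sjV).
have: ((j'^-1%g a).2 < n.-1)%N by apply: SDle_lt; rewrite ?groupV.
have: ((j'^-1%g b).2 < n.-1)%N by apply: SDle_lt; rewrite ?groupV.
case: (j'^-1%g a) (j'^-1%g b) => [c i] [d k] /= km im; rewrite -(inj_eq val_inj) /= => ik.
rewrite /shift /pmZ /= !(fun_if val) /= !modn_small; try lia.
by case: p => -[] q /=; case: c d => [] []; do !case: ifP => /=; lia.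
Qed.

Lemma inverted_ins_perm_top p a : (a.2 < n.-1)%N ->
  inverted (ins_perm j' p) a top = (pmZ p < pmZ (shift p (j'^-1%g a))).
Proof.
by move=> am; rewrite inverted_top // ins_perm_inv_top ins_perm_inv.
Qed.

End InsertionInverse.

(* The sign flip of the first entry exchanges the positions [1] and [-1] of [j']
   when [p < 0], which makes [p = -1] exceptional. *)
Lemma pmZ_shift_gt p y : (y.2 < n.-1)%N ->
  (pmZ p < pmZ (shift p y)) =
    (if pmZ p == -1 then (pmZ y == -1) || (2 <= pmZ y)
     else if 0 < pmZ p then pmZ p <= pmZ y else pmZ p < pmZ y).
Proof.
case: p y => [d q] [c i] /= im; rewrite /pmZ /shift /= !(fun_if val) /= modn_small; last by lia.
by case: c d => [] []; rewrite /= ?andbF; do !case: ifP => /=; lia.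
Qed.

(** Says which positions of [j'] may be lost when n moves on to [q]: only [z] or earlier ones, and
    never -1 when [z] is at 1. *)
Lemma next_position p z : (z.2 < n.-1)%N -> pmZ p < pmZ (shift p z) ->
  exists2 q, pmZ p < pmZ q & forall y, (y.2 < n.-1)%N ->
    pmZ p < pmZ (shift p y) -> ~~ (pmZ q < pmZ (shift q y)) ->
    y = z \/ (pmZ y < pmZ z /\ (pmZ y = -1 -> pmZ z <> 1)).
Proof.
move=> zm; rewrite pmZ_shift_gt // => p_lt_z.
have z_bd : (0 < `|pmZ z| < n)%N by case: (z) zm => [[] i]; rewrite /pmZ /=; lia.
have p_bd : (0 < `|pmZ p| <= n)%N by case: (p) => [[] i]; rewrite /pmZ /=; have := ltn_ord i; lia.
(* Each move loses one position. From -2, n can go to -1, losing position 1, or to 1, losing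
   position -1; the choice keeps the loss at or before [z]. From -1 it skips to 2, as going to 1
   would regain position 1. *)
pose Q : int := if 0 < pmZ p then pmZ p + 1 else if pmZ p == -1 then 2
  else if pmZ p == -2 then if pmZ z == 1 then -1 else 1 else pmZ p + 1.
have [q qE] : exists q, pmZ q = Q.
  by apply: pmZ_onto; move: p_lt_z; rewrite /Q; do !case: ifP; lia.
exists q; first by rewrite qE /Q; do !case: ifP; lia.
move=> y ym; rewrite !pmZ_shift_gt // qE => py qy.
have y_neq0 : pmZ y != 0 by case: (y) => [[] i]; rewrite /pmZ /=; lia.
have [yz|yz] := eqVneq (pmZ y) (pmZ z); first by left; apply: pmZ_inj.
by right; move: py qy p_lt_z yz; rewrite /Q; do !case: ifP; rewrite ?ltr01 ?ltr0n /=; lia.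
Qed.

(* An entry standing between the opposite values [- k] and [k], hence passable
   from either of them; being positive it rules out a descent from [- k] followed
   by an ascent to [k]. *)
Lemma positive_between j' (k : pm n) : j' \in SDle n n.-1 ->
    pmZ (j'^-1%g (pmN k)) < pmZ (j'^-1%g k) ->
    (pmZ (j'^-1%g (pmN k)) = -1 -> pmZ (j'^-1%g k) <> 1) ->
  exists a, [/\ (a.2 < n.-1)%N, a.2 != k.2, 0 < pmZ a,
    pmZ (j'^-1%g (pmN k)) < pmZ (j'^-1%g a) & pmZ (j'^-1%g a) < pmZ (j'^-1%g k)].
Proof.
move=> j'W; have [sj _ _] := SDleP _ _ j'W; have sjV := signedV sj.
rewrite sjV pmZN => lt_k k_neq1.
have k_gt1 : 1 < pmZ (j'^-1%g k).
  by move: lt_k k_neq1; case: (j'^-1%g k) => [[] i]; rewrite /pmZ /=; lia.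
have n_gt0 : (0 < n)%N by lia.
(* The witness is the positive one of the two opposite values at positions 1 and -1; [k] stands
   beyond position 1. *)
have [z z0 z_pos] : exists2 z : pm n, z.2 = 0%N :> nat & (j' z).1 = false.
  case E: (j' (false, Ordinal n_gt0)).1; last by exists (false, Ordinal n_gt0).
  exists (true, Ordinal n_gt0) => //.
  by rewrite -[(true, _)]/(pmN (false, Ordinal n_gt0)) sj /= E.
exists (j' z); rewrite permK; split.
- by apply: SDle_lt; rewrite // z0; lia.
- rewrite -(signed_index _ _ sjV) permK -(inj_eq val_inj) /= z0.
  by move: k_gt1; case: (j'^-1%g k) => [[] i]; rewrite /pmZ /=; lia.
- by move: z_pos; case: (j' z) => [c i] /= ->; rewrite /pmZ /=; lia.
- by move: z0 k_gt1; case: (z) => [[] i]; rewrite /pmZ /=; lia.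
- by move: z0 k_gt1; case: (z) => [[] i]; rewrite /pmZ /=; lia.
Qed.

End Insertion.

Theorem mainTheorem6 (n : nat) (n_ge3 : (3 <= n)%N)
    (u w uI wI j' : {perm pm n}) (u_SD : u \in SD n) (w_SD : w \in SD n)
    (uI_proj : is_parproj u uI) (wI_proj : is_parproj w wI)
    (j'_join : is_join (simpleDpar n) (SDpar n) uI wI j') :
  let good (j : {perm pm n}) :=
    forall k : int, (0 < `|k| < n)%N ->
      right_of_n u k || right_of_n w k -> right_of_n j k in
  exists p : pm n,
    [/\ good (ins_perm j' p),
        forall q : pm n, good (ins_perm j' q) -> pmZ q <= pmZ p &
        is_join (simpleD n) (SD n) u w (ins_perm j' p)].
Proof.
move=> good.
have m_ge2 : (2 <= n.-1)%N by lia.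
have n_ge2 : (2 <= n)%N by lia.
have le_mn := leq_pred n.
have [su _] := SDP _ u_SD; have [sw _] := SDP _ w_SD.
have [uIW uIE] := parproj_inverted n_ge3 u_SD uI_proj.
have [wIW wIE] := parproj_inverted n_ge3 w_SD wI_proj.
case: j'_join; rewrite SDpar_SDle // simpleDpar_simpleDlt //.
move=> j'W /(weak_le_SDle n_ge2 m_ge2 le_mn uIW j'W) le_uj
  /(weak_le_SDle n_ge2 m_ge2 le_mn wIW j'W) le_wj j'_min.
have [sj' _ _] := SDleP _ _ j'W.
have sjV := signedV sj'.
have JS p := ins_perm_SD n_ge3 j'W p.
have sJ p : signed (ins_perm j' p) by have [] := SDP _ (JS p).
pose R v x := inverted v x (top n_ge3).
pose needed x := R u x || R w x.
(* A boolean form of [good], so that a maximal position can be extracted. *)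
pose goodb p := [forall x : pm n, (x.2 < n.-1)%N ==> needed x ==> R (ins_perm j' p) x].
have goodP p : reflect (good (ins_perm j' p)) (goodb p).
  apply: (iffP forallP) => [gp | gp x].
    apply/(right_of_n_forall n_ge3) => x xm; rewrite !(right_of_nE n_ge3) // => Nx.
    by have := gp x; rewrite xm /needed Nx.
  apply/implyP=> xm; apply/implyP; move/(right_of_n_forall n_ge3): gp => /(_ x xm).
  by rewrite !(right_of_nE n_ge3).
have RJ p (x : pm n) : (x.2 < n.-1)%N -> R (ins_perm j' p) x = (pmZ p < pmZ (shift p (j'^-1%g x))).
  exact: inverted_ins_perm_top.
have inv_lt (x : pm n) : (x.2 < n.-1)%N -> ((j'^-1%g x).2 < n.-1)%N.
  by move=> xm; apply: SDle_lt; rewrite ?groupV.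
(* At position -n, every other value is to the right of n. *)
have good_min : goodb (true, (top n_ge3).2).
  apply/forallP=> x; apply/implyP=> xm; apply/implyP=> _; rewrite RJ //.
  move: (inv_lt x xm); case: (j'^-1%g x) => [c i] im; rewrite pmZ_shift_gt //.
  by move: im; rewrite /pmZ /=; case: c; do !case: ifP; lia.
case: (Order.TotalTheory.arg_maxP (@pmZ n) good_min) => p gp p_max.
exists p; split; first exact/goodP.
  by move=> q /goodP; apply: p_max.
have needed_below (k : pm n) : (k.2 < n.-1)%N -> R (ins_perm j' p) k ->
  exists2 m : pm n, (m.2 < n.-1)%N & needed m /\
    (m = k \/ (pmZ (j'^-1%g m) < pmZ (j'^-1%g k) /\
       (pmZ (j'^-1%g m) = -1 -> pmZ (j'^-1%g k) <> 1))).
  move=> km; rewrite RJ // => /(next_position n_ge3 (inv_lt _ km))[q lt_pq q_next].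
  (* Maximality of [p] makes [q] bad: some needed [m] is lost, and [next_position] locates it. *)
  have: ~~ goodb q by apply: contraTN lt_pq => /p_max; rewrite -leNgt.
  rewrite negb_forall => /existsP[m]; rewrite !negb_imply => /and3P[mm Nm].
  rewrite RJ // => nRq; exists m => //; split=> //.
  have pm : R (ins_perm j' p) m.
    by have /forallP/(_ m) := gp; rewrite mm Nm.
  rewrite RJ // in pm.
  by have [/perm_inj|] := q_next _ (inv_lt _ mm) pm nRq; [left|right].
have RE v (c : pm n) : (c.2 < n.-1)%N ->
  R v c = (pmZ (v^-1%g (top n_ge3)) < pmZ (v^-1%g c)) by exact: inverted_top.
have R_up v vI (a b : pm n) : (a.2 < n.-1)%N -> (b.2 < n.-1)%N ->
    inverted vI a b = inverted v a b -> (inverted vI a b -> inverted j' a b) ->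
    pmZ (j'^-1%g a) < pmZ (j'^-1%g b) -> pmZ a < pmZ b -> R v a -> R v b.
  move=> am bm vE le_v lt_ab ab_lt; rewrite !RE // => Ra; apply: lt_le_trans Ra _.
  have : ~~ inverted v a b.
    by rewrite -vE; apply/negP => /le_v; rewrite /inverted lt_ab ab_lt.
  by rewrite /inverted ab_lt addTb negbK => /ltW.
split; first exact: JS.
- apply: (@weak_le_top n n_ge3) => // [a b am bm ab | a am Ra].
    by rewrite inverted_ins_perm // -uIE // => /le_uj; apply.
  by have /forallP/(_ a) := gp; rewrite am /needed /R Ra.
- apply: (@weak_le_top n n_ge3) => // [a b am bm ab | a am Ra].
    by rewrite inverted_ins_perm // -wIE // => /le_wj; apply.
  by have /forallP/(_ a) := gp; rewrite am /needed /R Ra orbT.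
move=> x xS le_ux le_wx.
have [xI xIW xIE] := exists_parabolic_component n_ge3 xS.
have le_jx (a b : pm n) : (a.2 < n.-1)%N -> (b.2 < n.-1)%N -> a.2 != b.2 ->
    inverted j' a b -> inverted x a b.
  move=> am bm ab; rewrite -xIE //.
  (* The component [xI] lies above [uI] and [wI], so the join property of [j'] applies to it. *)
  have /(weak_le_SDle n_ge2 m_ge2 le_mn j'W xIW) : weak_le (simpleDlt n n.-1) j' xI.
    apply: j'_min => //; apply/weak_le_SDle => // c d cm dm cd; rewrite xIE // ?uIE ?wIE //.
      exact: weak_le_inverted.
    exact: weak_le_inverted.
  by apply.
apply: (@weak_le_top n n_ge3) => // [a b am bm ab | k km].
  by rewrite inverted_ins_perm //; apply: le_jx.
rewrite -/(R _ _) => /(needed_below k km)[m mm [Nm m_k]].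
have top_neq (c : pm n) : (c.2 < n.-1)%N -> c.2 != (top n_ge3).2.
  by apply: contraTneq => ->; rewrite ltnn.
have needed_x (c : pm n) : (c.2 < n.-1)%N -> needed c -> R x c.
  by move=> cm /orP[]; apply: weak_le_inverted => //; apply: top_neq.
have step_up (a b : pm n) : (a.2 < n.-1)%N -> (b.2 < n.-1)%N -> a.2 != b.2 ->
    pmZ (j'^-1%g a) < pmZ (j'^-1%g b) -> pmZ a < pmZ b -> needed a -> needed b.
  move=> am bm ab lt_ab ab_lt /orP[] Ra; apply/orP; [left | right].
    by apply: (@R_up u uI a b) => //; [apply: uIE | apply: le_uj].
  by apply: (@R_up w wI a b) => //; [apply: wIE | apply: le_wj].
have step_down (a b : pm n) : (a.2 < n.-1)%N -> (b.2 < n.-1)%N -> a.2 != b.2 ->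
    pmZ (j'^-1%g a) < pmZ (j'^-1%g b) -> pmZ b < pmZ a -> R x a -> R x b.
  move=> am bm ab lt_ab ba_lt; rewrite !RE // => Ra; apply: lt_le_trans Ra _.
  have : inverted x b a.
    apply: le_jx; rewrite 1?eq_sym // /inverted ba_lt addTb -leNgt.
    exact: ltW.
  by rewrite /inverted ba_lt addTb -leNgt.
have step (a b : pm n) : (a.2 < n.-1)%N -> (b.2 < n.-1)%N -> a.2 != b.2 ->
    pmZ (j'^-1%g a) < pmZ (j'^-1%g b) -> needed a -> R x b.
  move=> am bm ab lt_ab Na; case: (ltP (pmZ a) (pmZ b)) => [ab_lt | ba_le].
    by apply: needed_x => //; apply: step_up Na.
  apply: (step_down a b) => //; last exact: needed_x.
  rewrite lt_neqAle ba_le andbT; apply: contraNneq ab => /pmZ_inj->//.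
have [<-|[lt_mk middle]] := m_k; first exact: needed_x.
have [mk|mk] := boolP (m.2 != k.2); first exact: (step m k).
(* Opposite values form no reflection, so the passage from [m] to [k] goes through a positive value
   [a] between them. *)
have m_Nk : m = pmN k.
  move: mk; rewrite negbK eq_index => /orP[/eqP m_k'|/eqP//].
  by rewrite m_k' ltxx in lt_mk.
rewrite m_Nk in lt_mk middle.
have [a [am ak a_gt0 lt_ma lt_ak]] := positive_between n_ge3 j'W lt_mk middle.
have ma : m.2 != a.2 by rewrite eq_sym m_Nk.
rewrite -m_Nk in lt_ma.
case: (ltP (pmZ m) (pmZ a)) => [m_lt | m_ge].
  exact: (step a k am km ak lt_ak (step_up m a mm am ma lt_ma m_lt Nm)).
(* Here [m] is at least [a], hence positive, so [k] is negative and the passage from [a] to [k] is a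
   descent, for which [R x a] suffices. *)
apply: (step_down a k am km ak lt_ak) (step m a mm am ma lt_ma Nm).
apply: lt_trans (a_gt0); rewrite -oppr_gt0 -pmZN -m_Nk.
exact: lt_le_trans a_gt0 m_ge.
Qed.
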